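(* Let $G$ be a finite group, $H\subset G$ a subgroup, and $X=G/H$ with the left translation action of $G$. For $k,m\in\mathbb{Z}_{\ge 0}$ let $$f(k,m):=\sum_{h_1,\dots,h_m,a_1,\dots,a_k,b_1,\dots,b_k\in G}\#X^{h_1\cdots h_m[a_1,b_1]\cdots[a_k,b_k]}\prod_{i=1}^m\#X^{h_i}.$$ Then the following are equivalent: (1) $(G,H)$ is a Gelfand pair. (2) For all $k,m\in\mathbb{Z}_{\ge 0}$ and all integers $l$ with $0<l\le k$, $f(k,m)=f(k-l,m+2l)$. (3) For some $k,m\in\mathbb{Z}_{\ge 0}$ and some integer $l$ with $0<l\le k$, $f(k,m)=f(k-l,m+2l)$.
   Context: For $h\in G$, $X^h=\{x\in X:hx=x\}$, and $[a,b]=aba^{-1}b^{-1}$; empty products are the identity (or $1$). A finite $G$-set $X$ is multiplicity free if $\dim\operatorname{Hom}_G(\pi,\mathbb{C}[X])\le 1$ for every irreducible complex representation $\pi$ of $G$, where $\mathbb{C}[X]$ is the representation of $G$ on complex-valued functions on $X$. The pair $(G,H)$ is a Gelfand pair if $G/H$ is a multiplicity free $G$-set. *)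

(* Defs.v *)
From HB Require Import structures.
From mathcomp Require Import all_boot all_order all_algebra all_fingroup.
From mathcomp Require Import all_character.
From mathcomp Require Import reals.
From mathcomp Require Import complex.

Set Implicit Arguments.
Unset Strict Implicit.
Unset Printing Implicit Defensive.

Import GroupScope GRing.Theory.
Local Open Scope ring_scope.

(* A left action of G on a finite set. MathComp's {action _ &-> _} are right
   actions, so left G-sets are introduced here; the values of [gset_act] outside of
   G and outside of the carrier are irrelevant. *)
Record gset (gT : finGroupType) (G : {group gT}) (T : finType) := GSet {
  gset_carrier : {set T};
  gset_act : gT -> T -> T;
  gset_act_closed : forall g x, g \in G -> x \in gset_carrier -> gset_act g x \in gset_carrier;
  gset_act1 : forall x, x \in gset_carrier -> gset_act 1%g x = x;
  gset_actM : forall g h x, g \in G -> h \in G -> x \in gset_carrier ->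
    gset_act (g * h)%g x = gset_act g (gset_act h x)
}.

Definition gfix (gT : finGroupType) (G : {group gT}) (T : finType)
    (X : gset G T) (h : gT) : {set T} :=
  [set x in gset_carrier X | gset_act X h x == x].

Section Cosets.
Local Open Scope group_scope.
Variables (gT : finGroupType) (G H : {group gT}).

Lemma lcosets_closed (g : gT) (A : {set gT}) :
  g \in G -> A \in lcosets H G -> g *: A \in lcosets H G.
Proof.
move=> gG /lcosetsP[x xG ->]; rewrite -lcosetM.
by apply/lcosetsP; exists (g * x); rewrite ?groupM.
Qed.

Lemma lcosets_act1 (A : {set gT}) : A \in lcosets H G -> 1 *: A = A.
Proof. by move=> _; rewrite mul1g. Qed.

Lemma lcosets_actM (g h : gT) (A : {set gT}) :
  g \in G -> h \in G -> A \in lcosets H G ->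
  (g * h) *: A = g *: (h *: A).
Proof. by move=> _ _ _; rewrite lcosetM. Qed.

Definition coset_gset : gset G {set gT} :=
  GSet (gset_act := fun g A => g *: A) lcosets_closed lcosets_act1 lcosets_actM.

End Cosets.

Section FunctionRepresentation.
Variables (F : fieldType) (gT : finGroupType) (G : {group gT}) (T : finType).
Variable X : gset G T.

(* A row vector encodes a function f on X, through the enumeration of X.
   MathComp lets g act on row vectors by v |-> v *m rG g, i.e. as g^-1 in the
   corresponding left representation; for the left representation
   (g f)(x) = f (g^-1 x) this is f |-> (x |-> f (g x)), whose matrix is the
   one below. *)
Definition fun_mx (g : gT) : 'M[F]_#|gset_carrier X| :=
  \matrix_(i, j) (enum_val i == gset_act X g (enum_val j))%:R.

Lemma fun_mxE (v : 'rV[F]_#|gset_carrier X|) g j (gG : g \in G) :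
  (v *m fun_mx g) 0 j =
  v 0 (enum_rank_in (gset_act_closed gG (enum_valP j)) (gset_act X g (enum_val j))).
Proof.
set k := enum_rank_in _ _.
have kE : enum_val k = gset_act X g (enum_val j).
  by rewrite enum_rankK_in // gset_act_closed // enum_valP.
rewrite mxE (bigD1 k) //= !mxE kE eqxx mulr1 big1 ?addr0 // => i ik.
by rewrite !mxE -kE (inj_eq enum_val_inj) (negbTE ik) mulr0.
Qed.

Lemma fun_mx_repr : mx_repr G fun_mx.
Proof.
split=> [|g h gG hG].
  apply/matrixP=> i j; rewrite !mxE gset_act1 ?enum_valP //.
  by rewrite (inj_eq enum_val_inj).
apply/row_matrixP=> i; rewrite row_mul; apply/rowP=> j.
rewrite fun_mxE !mxE enum_rankK_in ?gset_act_closed ?enum_valP //.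
by rewrite gset_actM ?enum_valP.
Qed.

Definition fun_repr : mx_representation F G #|gset_carrier X| :=
  MxRepresentation fun_mx_repr.

End FunctionRepresentation.

(* Hom_G(rG, rG'), as a subspace of the space of matrices (acting on row
   vectors on the right). *)
Definition repr_hom (F : fieldType) (gT : finGroupType) (G : {group gT})
    (n m : nat) (rG : mx_representation F G n) (rG' : mx_representation F G m) :
    {vspace 'M[F]_(n, m)} :=
  (\bigcap_(g in G) lker (linfun (mulmx (rG g)) - linfun (mulmxr (rG' g))))%VS.

Lemma repr_homP (F : fieldType) (gT : finGroupType) (G : {group gT})
    (n m : nat) (rG : mx_representation F G n) (rG' : mx_representation F G m)
    (B : 'M[F]_(n, m)) :
  reflect (forall g, g \in G -> rG g *m B = B *m rG' g) (B \in repr_hom rG rG').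
Proof.
have kerE g : (B \in lker (linfun (mulmx (rG g)) - linfun (mulmxr (rG' g)))) =
              (rG g *m B == B *m rG' g).
  by rewrite memv_ker add_lfunE opp_lfunE !lfunE /= subr_eq0.
rewrite memvE; apply: (iffP subv_bigcapP) => homB g gG.
  by apply/eqP; rewrite -kerE memvE homB.
by rewrite -memvE kerE homB.
Qed.

(* The complex numbers are [complex R], for R the real numbers. *)
Definition multiplicity_free (R : realType) (gT : finGroupType)
    (G : {group gT}) (T : finType) (X : gset G T) : Prop :=
  forall (n : nat) (rG : mx_representation (complex R) G n),
    mx_irreducible rG -> (\dim (repr_hom rG (fun_repr (complex R) X)) <= 1)%N.

Definition gelfand_pair (R : realType) (gT : finGroupType)
    (G H : {group gT}) : Prop :=
  multiplicity_free R (coset_gset G H).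

(* MathComp's [~ a, b] is a^-1 * b^-1 * a * b. *)
Definition commutator_l (gT : finGroupType) (a b : gT) : gT :=
  (a * b * a^-1 * b^-1)%g.

(* The sum f(k,m); ffun_on G consists of the families of elements of G. *)
Definition fix_sum (gT : finGroupType) (G : {group gT}) (T : finType)
    (X : gset G T) (k m : nat) : nat :=
  (\sum_(h : {ffun 'I_m -> gT} | h \in ffun_on (mem G))
   \sum_(a : {ffun 'I_k -> gT} | a \in ffun_on (mem G))
   \sum_(b : {ffun 'I_k -> gT} | b \in ffun_on (mem G))
     #|gfix X ((\prod_(i < m) h i) * \prod_(i < k) commutator_l (a i) (b i))%g|
     * \prod_(i < m) #|gfix X (h i)|)%N.

(* Main.v *)
From HB Require Import structures.
Require Import Defs.
From mathcomp Require Import all_boot all_order all_algebra all_fingroup.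
From mathcomp Require Import all_solvable all_field all_character reals complex.

Set Implicit Arguments.
Unset Strict Implicit.
Unset Printing Implicit Defensive.

Import Order.TTheory GRing.Theory Num.Theory.
Local Open Scope ring_scope.

(* Let n_i be the multiplicity of the irreducible character chi_i in C[X]. The
   elements sum_h #X^h h and sum_(a,b) [a,b] of the group algebra are central, and act
   on the i-th irreducible representation as the scalars |G| n_i / chi_i(1) and
   (|G| / chi_i(1))^2. Taking traces,
     f(k,m) = sum_i chi_i(1) (|G| / chi_i(1))^(2k+m) n_i^(m+1),
   so f(k-l,m+2l) - f(k,m) is a combination with positive coefficients of the
   nonnegative numbers n_i^(m+1) (n_i^(2l) - 1), and it vanishes exactly when
   n_i <= 1 for all i.
   The library has character theory over the algebraic numbers only, whereas
   multiplicity freeness is stated over R[i]. Over any algebraically closed field of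
   characteristic 0 it means that End_G(F[X]) is commutative, and this does not depend
   on F, because End_G(F[X]) is spanned by matrices with rational entries. *)

(** * Traces of projections and averaging over the group *)

(** The trace of a projection onto [U] is [\dim U], and the right-hand side is this trace in the
    basis of matrix units. Both sides are compared through the coordinates of [p] in a basis of
    [U]. *)
Lemma dim_mx_proj (F : fieldType) (m n : nat) (U : {vspace 'M[F]_(m, n)})
    (p : {linear 'M[F]_(m, n) -> 'M[F]_(m, n)}) :
  (forall A, p A \in U) -> {in U, forall A, p A = A} ->
  (\dim U)%:R = \sum_i \sum_j p (delta_mx i j) i j.
Proof.
move=> pU p_id; pose X := vbasis U.
have XU : basis_of U X := vbasisP U.
transitivity (\sum_(k < \dim U) coord X k (p X`_k)).
  rewrite (eq_bigr (fun=> 1)) ?sumr_const ?card_ord // => k _.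
  rewrite p_id ?vbasis_mem ?mem_nth ?size_tuple //.
  by rewrite coord_free ?eqxx // (basis_free XU).
transitivity (\sum_i \sum_j \sum_k coord X k (p (delta_mx i j)) * X`_k i j).
  rewrite [RHS](eq_bigr (fun i => \sum_k \sum_j coord X k (p (delta_mx i j)) * X`_k i j));
    last by move=> i _; rewrite exchange_big.
  rewrite exchange_big; apply: eq_bigr => k _.
  rewrite {1}[X`_k]matrix_sum_delta !linear_sum; apply: eq_bigr => i _.
  rewrite !linear_sum; apply: eq_bigr => j _.
  by rewrite !linearZ /= mulrC.
apply: eq_bigr => i _; apply: eq_bigr => j _.
rewrite {2}(coord_vbasis (pU (delta_mx i j))) summxE.
by apply: eq_bigr => k _; rewrite mxE.
Qed.

Section Averaging.
Variables (F : numFieldType) (gT : finGroupType) (G : {group gT}).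

(** The Reynolds operator, a projection of the space of all matrices onto [repr_hom rG rG']. *)
Definition avg_hom (m n : nat) (rG : mx_representation F G m)
    (rG' : mx_representation F G n) (B : 'M[F]_(m, n)) : 'M[F]_(m, n) :=
  #|G|%:R^-1 *: \sum_(g in G) rG g^-1%g *m B *m rG' g.

Variables (m n : nat).
Variables (rG : mx_representation F G m) (rG' : mx_representation F G n).

Lemma avg_hom_is_linear : linear (avg_hom rG rG').
Proof.
move=> a A B; rewrite /avg_hom scalerA mulrC -scalerA -scalerDr.
congr (_ *: _); rewrite scaler_sumr -big_split; apply: eq_bigr => g _ /=.
by rewrite linearP /= mulmxDl -scalemxAl.
Qed.

HB.instance Definition _ :=
  GRing.isLinear.Build F 'M[F]_(m, n) 'M[F]_(m, n) *:%R (avg_hom rG rG')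
    avg_hom_is_linear.

Lemma avg_hom_mem B : avg_hom rG rG' B \in repr_hom rG rG'.
Proof.
apply/repr_homP => g gG; rewrite /avg_hom -scalemxAl -scalemxAr.
congr (_ *: _); rewrite mulmx_suml mulmx_sumr [LHS](reindex_acts 'R _ gG) ?astabsR //=.
apply: eq_bigr => x xG.
by rewrite !mulmxA -repr_mxM ?groupV ?groupM // invMg mulKVg -!mulmxA -repr_mxM.
Qed.

Lemma avg_hom_id : {in repr_hom rG rG', forall B, avg_hom rG rG' B = B}.
Proof.
move=> B /repr_homP homB; rewrite /avg_hom (eq_bigr (fun=> B)).
  by rewrite sumr_const -scaler_nat scalerA mulVf ?scale1r // pnatr_eq0 -lt0n.
by move=> g gG; rewrite homB ?groupV // -mulmxA -repr_mxM ?groupV // mulVg repr_mx1 mulmx1.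
Qed.

End Averaging.

(** * Multiplicity freeness as commutativity of the endomorphism algebra *)

Definition hom_comm (F : fieldType) (gT : finGroupType) (G : {group gT}) (n : nat)
    (rG : mx_representation F G n) : Prop :=
  {in repr_hom rG rG &, forall A B, A *m B = B *m A}.

(** If each irreducible has multiplicity at most 1, an endomorphism acts as a scalar on every simple
    submodule, so any two commute on the sum of these, which is everything by Maschke. Conversely,
    two independent embeddings of one irreducible yield endomorphisms that do not commute. *)
Lemma hom_comm_mult_le1 (F : numClosedFieldType) (gT : finGroupType)
    (G : {group gT}) (n : nat) (rX : mx_representation F G n) :
  (forall m (rG : mx_representation F G m),
     mx_irreducible rG -> (\dim (repr_hom rG rX) <= 1)%N) <-> hom_comm rX.
Proof.
have charFG : ([pchar F]^'.-group G)%g.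
  by rewrite /pgroup pcharf'_nat pnatr_eq0 -lt0n.
split=> [mult1 A B homA homB | commX m rG irrG].
  have scal U : mxsimple rX U ->
      {in repr_hom rX rX, forall C, exists c, U *m C = c *: U}.
    move=> simU C /repr_homP homC; have [modU nzU _] := simU.
    (* [V] is the inclusion of [U]; being nonzero, it spans the Hom space, so that [V *m C] is a
       multiple of [V]. *)
    pose V := val_submod (1%:M : 'M_(\rank U)).
    have homV : V \in repr_hom (submod_repr modU) rX.
      by apply/repr_homP=> g gG; rewrite -val_submodJ // mul1mx /V -val_submodE.
    have nzV : V != 0 by rewrite val_submod_eq0 -mxrank_eq0 mxrank1 mxrank_eq0.
    have homVC : V *m C \in repr_hom (submod_repr modU) rX.
      apply/repr_homP=> g gG; rewrite mulmxA (repr_homP _ _ _ homV) //.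
      by rewrite -!mulmxA homC.
    have: V *m C \in <[V]>%VS.
      suff <- : repr_hom (submod_repr modU) rX = <[V]>%VS by [].
      apply/esym/eqP; rewrite eqEdim dim_vline nzV -memvE homV mult1 //.
      exact/submod_mx_irr.
    case/vlineP=> c VC; exists c.
    rewrite -{1}[U](@in_submodK _ _ U) // val_submodE -mulmxA -/V VC.
    by rewrite -scalemxAr -val_submodE in_submodK.
  apply/eqP; rewrite -subr_eq0; set D := _ - _.
  apply: (mx_reducible_semisimple (mxmodule1 rX) (mx_Maschke_pchar rX charFG)).
  case=> I U /= simU defU _; rewrite -[D]mul1mx -submx0.
  have : (1%:M <= kermx D)%MS.
    rewrite -defU; apply/sumsmx_subP => i _; apply/sub_kermxP.
    have [a UA] := scal _ (simU i) _ homA; have [b UB] := scal _ (simU i) _ homB.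
    by rewrite mulmxBr !mulmxA UA UB -!scalemxAl UA UB !scalerA mulrC subrr.
  by move/sub_kermxP->; rewrite sub0mx.
rewrite leqNgt; apply/negP => dim_gt1.
pose A := vpick (repr_hom rG rX).
have homA : A \in repr_hom rG rX by apply: memv_pick.
have nzA : A != 0.
  by rewrite vpick0; apply: contraL dim_gt1 => /eqP->; rewrite dimv0.
have [B homB notB] : exists2 B, B \in repr_hom rG rX & B \notin <[A]>%VS.
  by apply/subvPn; apply: contraL dim_gt1 => /dimvS; rewrite dim_vline nzA -leqNgt.
have freeA : row_free A.
  rewrite -kermx_eq0; apply: contraR nzA => nzK; have [_ _ simG] := irrG.
  have modK : mxmodule rG (kermx A).
    apply/mxmoduleP=> g gG; apply/sub_kermxP.
    by rewrite -mulmxA (repr_homP _ _ _ homA) // mulmxA mulmx_ker mul0mx.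
  by have /sub_kermxP := simG _ modK (submx1 _) nzK; rewrite mul1mx => ->.
(* By Maschke A has an equivariant retraction P. By Schur P *m A and P *m B' fail to
   commute when B' is independent of A and killed by P. *)
pose P := avg_hom rX rG (pinvmx A).
have homP : P \in repr_hom rX rG by apply: avg_hom_mem.
have homM n1 n2 n3 (r1 : mx_representation F G n1) (r2 : mx_representation F G n2)
    (r3 : mx_representation F G n3) C D :
    C \in repr_hom r1 r2 -> D \in repr_hom r2 r3 -> C *m D \in repr_hom r1 r3.
  move=> /repr_homP homC /repr_homP homD; apply/repr_homP => g gG.
  by rewrite mulmxA homC // -!mulmxA homD.
have AP : A *m P = 1%:M.
  rewrite /P /avg_hom -scalemxAr mulmx_sumr (eq_bigr (fun=> 1%:M)).
    by rewrite sumr_const -scaler_nat scalerA mulVf ?scale1r // pnatr_eq0 -lt0n.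
  move=> g gG; rewrite 2!mulmxA -(repr_homP _ _ _ homA) ?groupV //.
  rewrite -(mulmxA _ A) (mulmxVp freeA) mulmx1.
  by rewrite -repr_mxM ?groupV // mulVg repr_mx1.
have [c BP] : exists c, B *m P = c%:M.
  apply/is_scalar_mxP/(mx_abs_irr_cent_scalar (rG := rG)).
    exact: group_closure_closed_field.
  by apply/centgmxP=> g gG; apply/esym/(repr_homP _ _ _ (homM _ _ _ _ _ _ _ _ homB homP)).
pose B' := B - c *: A.
have homB' : B' \in repr_hom rG rX by rewrite memvB ?memvZ.
have B'P : B' *m P = 0 by rewrite mulmxBl -scalemxAl AP BP scalemx1 subrr.
have := commX (P *m A) (P *m B') (homM _ _ _ _ _ _ _ _ homP homA)
  (homM _ _ _ _ _ _ _ _ homP homB').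
(* Since [A *m P = 1] and [B' *m P = 0], multiplying by [A] on the left leaves [B' = 0], which puts
   [B] on the line of [A]. *)
move/(congr1 (mulmx A)); rewrite !mulmxA AP !mul1mx AP mul1mx B'P mul0mx.
by move/eqP; rewrite subr_eq0 => /eqP defB; rewrite defB memvZ ?memv_line in notB.
Qed.

(** Averages of matrix units span the endomorphisms over [F] and come from rational endomorphisms.
    Commutation is bilinear, so it can be tested on them, one argument at a time. *)
Lemma hom_comm_ratr (F : numFieldType) (gT : finGroupType) (G : {group gT}) (n : nat)
    (rQ : mx_representation rat G n) (rF : mx_representation F G n) :
  (forall g, rF g = map_mx ratr (rQ g)) -> hom_comm rF <-> hom_comm rQ.
Proof.
move=> rFE; split=> comm A B homA homB.
  have map_hom C : C \in repr_hom rQ rQ -> map_mx ratr C \in repr_hom rF rF.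
    move=> /repr_homP homC; apply/repr_homP => g gG.
    by rewrite rFE -!map_mxM homC.
  apply: (map_mx_inj (f := ratr : rat -> F)).
  by rewrite !map_mxM; apply: comm; apply: map_hom.
have avgE i j : avg_hom rF rF (delta_mx i j) = map_mx ratr (avg_hom rQ rQ (delta_mx i j)).
  rewrite /avg_hom map_mxZ fmorphV rmorph_nat; congr (_ *: _).
  rewrite raddf_sum; apply: eq_bigr => g _ /=.
  by rewrite !map_mxM !rFE map_delta_mx.
pose D i j := avg_hom rF rF (delta_mx i j).
have span C M : M \in repr_hom rF rF ->
    (forall i j, C *m D i j = D i j *m C) -> C *m M = M *m C.
  move=> homM; have -> : M = \sum_i \sum_j M i j *: D i j.
    rewrite -{1}(avg_hom_id homM) {1}[M]matrix_sum_delta linear_sum.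
    apply: eq_bigr => i _; rewrite linear_sum.
    by apply: eq_bigr => j _; rewrite linearZ.
  move=> commD; rewrite mulmx_sumr mulmx_suml; apply: eq_bigr => i _.
  rewrite mulmx_sumr mulmx_suml; apply: eq_bigr => j _.
  by rewrite -scalemxAl -scalemxAr commD.
apply: (span _ _ homB) => i j; apply/esym/(span _ _ homA) => k l.
by rewrite /D !avgE -!map_mxM comm ?avg_hom_mem.
Qed.

(** * Dimensions of Hom spaces as inner products of characters *)

(** This is the trace of the averaging projection: the map [B |-> S *m B *m T] has trace
    [\tr S * \tr T]. *)
Lemma dim_repr_hom (F : numFieldType) (gT : finGroupType) (G : {group gT}) (m n : nat)
    (rG : mx_representation F G m) (rG' : mx_representation F G n) :
  (\dim (repr_hom rG rG'))%:R =
    #|G|%:R^-1 * \sum_(g in G) \tr (rG g^-1%g) * \tr (rG' g) :> F.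
Proof.
rewrite (dim_mx_proj (p := avg_hom rG rG')); last 2 first.
- exact: avg_hom_mem.
- exact: avg_hom_id.
rewrite mulr_sumr (eq_bigr (fun g => \sum_i \sum_j
    #|G|%:R^-1 * (rG g^-1%g i i * rG' g j j))); last first.
  move=> g _; rewrite /mxtrace mulr_suml mulr_sumr; apply: eq_bigr => i _.
  by rewrite !mulr_sumr.
rewrite [RHS]exchange_big; apply: eq_bigr => i _.
rewrite [RHS]exchange_big; apply: eq_bigr => j _.
rewrite mxE summxE mulr_sumr; apply: eq_bigr => g _.
rewrite mxE (bigD1 j) //= big1 ?addr0 => [|k kj].
  rewrite mxE (bigD1 i) //= big1 ?addr0 => [|k ki]; last by rewrite !mxE (negbTE ki) mulr0.
  by rewrite mxE !eqxx mulr1.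
by rewrite mxE big1 ?mul0r // => l _; rewrite mxE (negbTE kj) andbF mulr0.
Qed.

Lemma dim_repr_hom_cfdot (gT : finGroupType) (G : {group gT}) (m n : nat)
    (rG : mx_representation algC G m) (rG' : mx_representation algC G n) :
  (\dim (repr_hom rG rG'))%:R = '[cfRepr rG', cfRepr rG].
Proof.
rewrite dim_repr_hom cfdotE; congr (_ * _); apply: eq_bigr => g gG.
by rewrite -char_inv ?cfRepr_char // !cfunE groupV gG !mulr1n mulrC.
Qed.

Lemma mult_le1_cfdot (gT : finGroupType) (G : {group gT}) (n : nat)
    (rX : mx_representation algC G n) :
  (forall m (rG : mx_representation algC G m),
     mx_irreducible rG -> (\dim (repr_hom rG rX) <= 1)%N) <->
  (forall i, '[cfRepr rX, 'chi[G]_i] <= 1).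
Proof.
split=> [mult1 i | mult1 m rG irrG].
  have /irr_reprP[rG irrG ->] := mem_irr i.
  by rewrite -dim_repr_hom_cfdot lern1 mult1.
have : cfRepr rG \in irr G by apply/irr_reprP; exists (Representation rG).
case/irrP=> i chi_i; rewrite -(ler_nat algC) dim_repr_hom_cfdot chi_i; exact: mult1.
Qed.

(** * Scalars by which central elements act on an irreducible representation *)

Section CentralScalars.
Variables (gT : finGroupType) (G : {group gT}) (n : nat).
Variable rG : mx_representation algC G n.
Hypothesis irrG : mx_irreducible rG.
Let chi := cfRepr rG.

Lemma irr_cent_scalar (A : 'M_n) :
  (forall g, g \in G -> rG g *m A = A *m rG g) -> A = (\tr A / n%:R)%:M.
Proof.
move=> cA; have absG := group_closure_closed_field irrG.
have /is_scalar_mxP[c ->] : is_scalar_mx A.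
  by apply: (mx_abs_irr_cent_scalar absG); apply/centgmxP => g gG; rewrite cA.
rewrite mxtrace_scalar -(mulr_natr c) mulfK // pnatr_eq0 -lt0n.
by case/mx_irrP: irrG.
Qed.

(** [phi] is constant on conjugacy classes, so the sum commutes with [rG] and is scalar by Schur.
    Its trace gives the value; [chi] gets conjugated because the inner product conjugates its second
    argument. *)
Lemma irr_class_sum (phi : 'CF(G)) :
  \sum_(g in G) phi g *: rG g = (#|G|%:R / n%:R * '[phi, chi^*%CF])%:M.
Proof.
rewrite [LHS]irr_cent_scalar => [|g gG].
  congr _%:M; rewrite cfdotE mulrACA mulfV ?neq0CG // mul1r [RHS]mulrC.
  congr (_ * _); rewrite raddf_sum; apply: eq_bigr => x xG.
  by rewrite /= mxtraceZ !cfunE conjCK xG mulr1n.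
rewrite mulmx_suml mulmx_sumr [LHS](reindex_acts 'J _ gG) ?astabsJ ?normG //.
apply: eq_bigr => x xG /=; rewrite -scalemxAl -scalemxAr cfunJ // -!repr_mxM ?groupJ //.
by rewrite conjgE !mulgA mulgV mul1g.
Qed.

(** For fixed [b], the conjugates of [rG b] average to the scalar [chi b / n]. What remains is a sum
    of [chi b *: rG b^-1], an instance of [irr_class_sum] in which the norm of [chi] is 1. *)
Lemma irr_commutator_sum :
  \sum_(a in G) \sum_(b in G) rG (commutator_l a b) = ((#|G|%:R / n%:R) ^+ 2)%:M.
Proof.
rewrite exchange_big.
have conj_sum b : b \in G ->
    \sum_(a in G) rG (a * b * a^-1)%g = (#|G|%:R / n%:R * chi b)%:M.
  move=> bG; have : avg_hom rG rG (rG b) = (chi b / n%:R)%:M.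
    rewrite [LHS]irr_cent_scalar; last by apply/repr_homP/avg_hom_mem.
    congr (_ / _)%:M; rewrite /avg_hom mxtraceZ raddf_sum.
    rewrite (eq_bigr (fun=> \tr (rG b))) => [|g gG] /=.
      by rewrite sumr_const -(mulr_natl (\tr _)) mulKf ?neq0CG // cfunE bG.
    by rewrite mxtrace_mulC mulmxA -repr_mxM ?groupV // mulgV repr_mx1 mul1mx.
  move/(congr1 ( *:%R #|G|%:R)); rewrite /avg_hom scalerA mulfV ?neq0CG // scale1r.
  rewrite (reindex_inj invg_inj) (eq_bigl (mem G)) => [avgE|a]; last by rewrite /= groupV.
  rewrite scale_scalar_mx mulrA mulrAC in avgE; rewrite -avgE.
  by apply: eq_bigr => a aG; rewrite invgK -!repr_mxM ?groupM ?groupV.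
transitivity (\sum_(b in G) (#|G|%:R / n%:R * chi b) *: rG b^-1%g).
  apply: eq_bigr => b bG; rewrite -mul_scalar_mx -conj_sum // mulmx_suml.
  by apply: eq_bigr => a aG; rewrite -repr_mxM ?groupM ?groupV.
rewrite (reindex_inj invg_inj) (eq_bigl (mem G)) => [|a]; last by rewrite /= groupV.
transitivity ((#|G|%:R / n%:R) *: \sum_(b in G) chi^*%CF b *: rG b).
  rewrite scaler_sumr; apply: eq_bigr => b bG.
  by rewrite invgK scalerA cfConjCE char_inv ?cfRepr_char.
rewrite irr_class_sum cfdot_conjC.
have /irrP[i chi_i] : chi \in irr G by apply/irr_reprP; exists (Representation rG).
by rewrite chi_i cfnorm_irr conjC1 mulr1 scale_scalar_mx.
Qed.

Lemma repr_mx_prod (I : finType) (h : I -> gT) :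
  (forall i, h i \in G) -> rG (\prod_i h i)%g = \prod_i rG (h i) :> 'M_n.
Proof.
move=> hG; suff [] : (\prod_i h i)%g \in G /\ rG (\prod_i h i)%g = \prod_i rG (h i) by [].
apply: (big_ind2 (fun x A => x \in G /\ rG x = A)) => [|x A y B [xG <-] [yG <-]|i _] //.
  by rewrite repr_mx1.
by rewrite groupM // repr_mxM.
Qed.

(** By distributivity the sum over families factors into [m] copies of the sum in [irr_class_sum]
    and [k] copies of the sum in [irr_commutator_sum]. *)
Lemma irr_word_sum (phi : 'CF(G)) (k m : nat) :
  \sum_(h : {ffun 'I_m -> gT} | h \in ffun_on (mem G))
   \sum_(a : {ffun 'I_k -> gT} | a \in ffun_on (mem G))
   \sum_(b : {ffun 'I_k -> gT} | b \in ffun_on (mem G))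
    (\prod_(i < m) phi (h i)) *:
    rG ((\prod_(i < m) h i) * \prod_(i < k) commutator_l (a i) (b i))%g
  = ((#|G|%:R / n%:R) ^+ (2 * k + m) * '[phi, chi^*%CF] ^+ m)%:M.
Proof.
set c := #|G|%:R / n%:R.
have -> : (c ^+ (2 * k + m) * '[phi, chi^*%CF] ^+ m)%:M =
    (\prod_(i < m) \sum_(g in G) phi g *: rG g) *
    (\prod_(i < k) \sum_(a in G) \sum_(b in G) rG (commutator_l a b)) :> 'M_n.
  rewrite irr_class_sum irr_commutator_sum !prodr_const !card_ord -!rmorphXn -rmorphM.
  by rewrite /= -/c -exprM exprD (exprMn m c) -mulrA [X in X%:M = _]mulrC.
rewrite !bigA_distr_big mulr_suml; apply: eq_bigr => h /ffun_onP hG.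
rewrite mulr_sumr; apply: eq_bigr => a /ffun_onP aG.
rewrite bigA_distr_big mulr_sumr; apply: eq_bigr => b /ffun_onP bG.
have cG i : commutator_l (a i) (b i) \in G.
  by rewrite !groupM ?groupV.
rewrite repr_mxM ?group_prod // !repr_mx_prod //.
rewrite [RHS]/GRing.mul /= scalemxAl; congr (_ *m _).
elim/big_rec3: _ => [|i _ A y _ <-]; first by rewrite scale1r.
by rewrite /GRing.mul /= -scalemxAl -scalemxAr scalerA.
Qed.
End CentralScalars.

(** * The sum f(k,m) in terms of multiplicities *)

Lemma cfRepr_fun_repr (gT : finGroupType) (G : {group gT}) (T : finType)
    (X : gset G T) (g : gT) :
  g \in G -> cfRepr (fun_repr algC X) g = #|gfix X g|%:R.
Proof.
move=> gG; have -> : #|gfix X g| = (\sum_(x in gset_carrier X | gset_act X g x == x) 1)%N.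
  by rewrite -sum1_card; apply: eq_bigl => x; rewrite inE.
rewrite cfunE gG mulr1n big_enum_val_cond natr_sum big_mkcond; apply: eq_bigr => j _.
by rewrite mxE eq_sym; case: eqP.
Qed.

(** The fixed points of the long word are counted by the permutation character, which is split into
    irreducibles; each ['chi_i] is the trace of ['Chi_i], and [irr_word_sum] applies. This splitting
    gives one factor [mult i], and the [m] single letters give the others. *)
Lemma fix_sum_irr (gT : finGroupType) (G : {group gT}) (T : finType)
    (X : gset G T) (k m : nat) (mult := fun i => '[cfRepr (fun_repr algC X), 'chi[G]_i]) :
  (fix_sum X k m)%:R =
  \sum_i 'chi[G]_i 1%g * (#|G|%:R / 'chi_i 1%g) ^+ (2 * k + m) * mult i ^+ m.+1.
Proof.
set theta := cfRepr _ in mult *.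
have theta_char : theta \is a character by apply: cfRepr_char.
have theta_real : (theta^*)%CF = theta.
  by apply/cfun_inP=> g gG; rewrite cfConjCE cfRepr_fun_repr // conjC_nat.
transitivity (\sum_i mult i * \tr (
   \sum_(h : {ffun 'I_m -> gT} | h \in ffun_on (mem G))
   \sum_(a : {ffun 'I_k -> gT} | a \in ffun_on (mem G))
   \sum_(b : {ffun 'I_k -> gT} | b \in ffun_on (mem G))
    (\prod_(i < m) theta (h i)) *:
    'Chi_i ((\prod_(i < m) h i) * \prod_(i < k) commutator_l (a i) (b i))%g)).
  under [RHS]eq_bigr => i _ do rewrite raddf_sum mulr_sumr.
  rewrite [RHS]exchange_big /fix_sum natr_sum; apply: eq_bigr => h /ffun_onP hG.
  under [RHS]eq_bigr => i _ do rewrite raddf_sum mulr_sumr.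
  rewrite [RHS]exchange_big natr_sum; apply: eq_bigr => a /ffun_onP aG.
  under [RHS]eq_bigr => i _ do rewrite raddf_sum mulr_sumr.
  rewrite [RHS]exchange_big natr_sum; apply: eq_bigr => b /ffun_onP bG /=.
  set w := (_ * _)%g; have wG : w \in G.
    by rewrite groupM ?group_prod // => i _; rewrite !groupM ?groupV.
  rewrite natrM natr_prod -cfRepr_fun_repr // -/theta.
  rewrite (eq_bigr (fun i => theta (h i))) => [|i _]; last by rewrite -cfRepr_fun_repr.
  rewrite {1}(cfun_sum_cfdot theta) sum_cfunE mulr_suml; apply: eq_bigr => i _.
  rewrite cfunE mxtraceZ -/(mult i) -mulrA [X in _ * X]mulrC; congr (_ * (_ * _)).
  by rewrite -irrRepr cfunE wG mulr1n.
apply: eq_bigr => i _.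
rewrite (irr_word_sum (socle_irr _)) mxtrace_scalar irrRepr.
(* The conjugate disappears because [theta] is real and multiplicities are natural numbers. *)
have -> : '[theta, ('chi_i)^*%CF] = mult i.
  by rewrite -{1}theta_real cfdot_conjC conj_natr ?Cnat_cfdot_char_irr.
rewrite -(mulr_natl (_ * _)) irr1_degree exprS.
by rewrite mulrCA -[RHS]mulrA; congr (_ * _); rewrite mulrCA.
Qed.

Lemma fix_sum_eq_mult_le1 (gT : finGroupType) (G : {group gT}) (T : finType)
    (X : gset G T) (k m l : nat) :
  (0 < l <= k)%N ->
  fix_sum X k m = fix_sum X (k - l) (m + 2 * l) <->
  (forall i, '[cfRepr (fun_repr algC X), 'chi[G]_i] <= 1).
Proof.
case/andP=> l_gt0 le_lk; set theta := cfRepr _.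
have theta_char : theta \is a character by apply: cfRepr_char.
pose w i := 'chi[G]_i 1%g * (#|G|%:R / 'chi_i 1%g) ^+ (2 * k + m).
have w_gt0 i : 0 < w i.
  by rewrite mulr_gt0 ?exprn_gt0 ?divr_gt0 ?irr1_gt0 // gt0CG.
(* The exponent of [#|G| / 'chi_i 1] is the same in both sums, so they share the weights [w i]. *)
have expE : (2 * (k - l) + (m + 2 * l) = 2 * k + m)%N.
  by rewrite addnCA -mulnDr subnK // addnC.
have term_ge0 i : 0 <= w i * ('[theta, 'chi_i] ^+ (m + 2 * l).+1 - '[theta, 'chi_i] ^+ m.+1).
  have /natrP[[|d] ->] := Cnat_cfdot_char_irr i theta_char.
    by rewrite !expr0n subrr mulr0.
  by rewrite pmulr_rge0 // subr_ge0 ler_weXn2l ?ler1n // ltnS leq_addr.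
have diffE : (fix_sum X (k - l) (m + 2 * l))%:R - (fix_sum X k m)%:R =
    \sum_i w i * ('[theta, 'chi_i] ^+ (m + 2 * l).+1 - '[theta, 'chi_i] ^+ m.+1).
  rewrite !fix_sum_irr expE -sumrB; apply: eq_bigr => i _.
  by rewrite mulrBr.
have mult_le1 i : ('[theta, 'chi_i] <= 1) =
   (w i * ('[theta, 'chi_i] ^+ (m + 2 * l).+1 - '[theta, 'chi_i] ^+ m.+1) == 0).
  rewrite mulf_eq0 gt_eqF //= subr_eq0.
  (* Multiplicities 0 and 1 have equal powers, the exponents being positive. From 2 on, equal powers
     would force [2 * l = 0]. *)
  have /natrP[[|[|d]] ->] := Cnat_cfdot_char_irr i theta_char.
  - by rewrite !expr0n eqxx ler01.
  - by rewrite !expr1n eqxx lexx.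
  rewrite -!natrX eqr_nat eqn_exp2l // lern1 eqSS -{2}[m]addn0 eqn_add2l.
  by rewrite muln_eq0 (gtn_eqF l_gt0).
split=> [eq_f i | le1].
  have sum0 : \sum_i w i * ('[theta, 'chi_i] ^+ (m + 2 * l).+1 - '[theta, 'chi_i] ^+ m.+1) = 0.
    by rewrite -diffE eq_f subrr.
  by rewrite mult_le1; apply/eqP; apply: (psumr_eq0P (fun i _ => term_ge0 i) sum0).
apply/eqP; rewrite -(eqr_nat algC) eq_sym -subr_eq0 diffE big1 // => i _.
by apply/eqP; rewrite -mult_le1.
Qed.

(** * Change of field and the equivalence *)

(** Commutativity of endomorphisms passes from [complex R] down to [rat] and up to [algC], where
    characters compute the multiplicities. *)
Lemma multiplicity_free_cfdot (R : realType) (gT : finGroupType) (G : {group gT})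
    (T : finType) (X : gset G T) :
  multiplicity_free R X <-> (forall i, '[cfRepr (fun_repr algC X), 'chi[G]_i] <= 1).
Proof.
have fun_ratr (F : numFieldType) g : fun_mx F X g = map_mx ratr (fun_mx rat X g).
  by apply/matrixP=> i j; rewrite !mxE rmorph_nat.
have := hom_comm_ratr (rF := fun_repr algC X) (rQ := fun_repr rat X) (fun_ratr _).
have := hom_comm_ratr (rF := fun_repr (complex R) X) (rQ := fun_repr rat X) (fun_ratr _).
have := hom_comm_mult_le1 (fun_repr (complex R) X).
have := hom_comm_mult_le1 (fun_repr algC X).
have := mult_le1_cfdot (fun_repr algC X).
rewrite /multiplicity_free; tauto.
Qed.

Local Close Scope ring_scope.

Theorem corollary4p3 (R : realType) (gT : finGroupType) (G H : {group gT})
    (sHG : H \subset G) :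
  let f := fix_sum (coset_gset G H) in
  [<-> gelfand_pair R G H;
       forall k m l : nat, 0 < l <= k -> f k m = f (k - l) (m + 2 * l);
       exists k m l : nat, 0 < l <= k /\ f k m = f (k - l) (m + 2 * l)].
Proof.
have gelfandE := multiplicity_free_cfdot R (coset_gset G H).
move=> f; tfae=> [gelfand k m l lk | eq_f | [k [m [l [lk eq_f]]]]].
- exact/(fix_sum_eq_mult_le1 _ _ lk)/gelfandE.
- by exists 1%N, 0%N, 1%N; split=> //; apply: eq_f.
- exact/gelfandE/(fix_sum_eq_mult_le1 _ m lk).
Qed.
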